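(* Let $G=\langle g_1,\dots,g_n\rangle$ be a finitely generated (discrete) group, let $\lambda$ be its left regular representation on $\ell^2(G)$, and let $A_\lambda(z)=z_0I+z_1\lambda(g_1)+\cdots+z_n\lambda(g_n)$. Then $G$ is amenable if and only if $H_0\subset p(A_\lambda)$, where $H_0=\{z\in\mathbb{P}^n\mid z_0+z_1+\cdots+z_n=0\}$.
   Context: $\mathbb{P}^n$ is complex projective space with homogeneous coordinates $z=[z_0:z_1:\cdots:z_n]$. For a unitary representation $\pi$ of $G=\langle g_1,\dots,g_n\rangle$ on a complex Hilbert space $\mathcal{H}$, put $A_\pi(z)=z_0I+z_1\pi(g_1)+\cdots+z_n\pi(g_n)$. The projective spectrum $p(A_\pi)$ is the set of $z\in\mathbb{P}^n$ such that $A_\pi(z)$ is not invertible in the algebra $B(\mathcal{H})$ of bounded operators. The left regular representation is $(\lambda(g)f)(x)=f(g^{-1}x)$ for $f\in\ell^2(G)$, $g,x\in G$. $G$ is amenable if there is a state $\phi$ on $L^\infty(G)$ with $\phi({}_gf)=\phi(f)$ for all $f\in L^\infty(G)$, $g\in G$, where ${}_gf(x)=f(g^{-1}x)$. *)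

(* Defs.v *)
From HB Require Import structures.
From mathcomp Require Import all_boot all_order all_algebra.
From mathcomp Require Import complex.
From mathcomp Require Import all_classical all_reals all_analysis.
From mathcomp Require Import ring lra.

Set Implicit Arguments.
Unset Strict Implicit.
Unset Printing Implicit Defensive.

Import Order.TTheory GRing.Theory Num.Theory.
Import numFieldNormedType.Exports Normc.

Local Open Scope classical_set_scope.
Local Open Scope ring_scope.
Local Open Scope complex_scope.
Local Open Scope quotient_scope.

Section ProjectiveSpace.
Variables (F : fieldType) (n : nat).

Definition homogeneous_coordinates := {z : 'rV[F]_n.+1 | z != 0}.

Definition proportional (z w : homogeneous_coordinates) : bool :=
  `[< exists2 c : F, c != 0 & val w = c *: val z >].

Lemma proportional_refl : reflexive proportional.
Proof. by move=> z; apply/asboolP; exists 1; rewrite ?oner_neq0 ?scale1r. Qed.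

Lemma proportional_sym : symmetric proportional.
Proof.
have H z w : proportional z w -> proportional w z.
  move=> /asboolP[c c0 e]; apply/asboolP; exists c^-1; first by rewrite invr_eq0.
  by rewrite e scalerA mulVf// scale1r.
by move=> z w; apply/idP/idP; exact: H.
Qed.

Lemma proportional_trans : transitive proportional.
Proof.
move=> w z u /asboolP[c c0 e] /asboolP[d d0 e']; apply/asboolP.
by exists (d * c); rewrite ?mulf_neq0// e' e scalerA.
Qed.

Canonical proportional_equiv := EquivRel proportional
  proportional_refl proportional_sym proportional_trans.

Definition projective_space := {eq_quot proportional}.

HB.instance Definition _ := Choice.on projective_space.
HB.instance Definition _ := EqQuotient.on projective_space.

Lemma repr_proportional (z : homogeneous_coordinates) :
  exists2 c : F, c != 0 & val (repr (\pi_projective_space z)) = c *: val z.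
Proof.
suff : proportional z (repr (\pi_projective_space z)) by move/asboolP.
have /eqmodP // : z = repr (\pi_projective_space z) %[mod projective_space].
by rewrite reprK.
Qed.

Definition hyperplane0 : set projective_space :=
  [set p : projective_space | \sum_(i < n.+1) val (repr p) 0 i = 0].

(* Membership does not depend on the representative. *)
Lemma hyperplane0P (z : homogeneous_coordinates) :
  hyperplane0 (\pi z) <-> \sum_(i < n.+1) val z 0 i = 0.
Proof.
rewrite /hyperplane0/=; have [c c0 ->] := repr_proportional z.
under eq_bigr do rewrite mxE.
rewrite -mulr_sumr; split=> [/eqP|->]; last by rewrite mulr0.
by rewrite mulf_eq0 (negbTE c0) => /eqP.
Qed.

End ProjectiveSpace.

Section BoundedOperators.
Variables (K : numFieldType) (H : normedModType K).

Definition bounded_operator (T : H -> H) : Prop :=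
  linear T /\ exists M : K, forall x, `|T x| <= M * `|x|.

(* Invertibility, in the algebra B(H), of an element T of B(H). *)
Definition invertible_operator (T : H -> H) : Prop :=
  exists S : H -> H, [/\ bounded_operator S, cancel T S & cancel S T].

Lemma bounded_operatorD (S T : H -> H) : bounded_operator S -> bounded_operator T ->
  bounded_operator (fun x => S x + T x).
Proof.
move=> [lS [M SM]] [lT [N TN]]; split.
  by move=> a x y; rewrite lS lT scalerDr addrACA.
exists (M + N) => x; rewrite mulrDl (le_trans (ler_normD _ _))//.
by rewrite lerD.
Qed.

Lemma bounded_operatorZ (c : K) (T : H -> H) : bounded_operator T ->
  bounded_operator (fun x => c *: T x).
Proof.
move=> [lT [N TN]]; split.
  by move=> a x y; rewrite lT scalerDr !scalerA mulrC.
by exists (`|c| * N) => x; rewrite normrZ -mulrA ler_wpM2l.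
Qed.

Lemma bounded_operator_id : bounded_operator id.
Proof. by split=> //; exists 1 => x; rewrite mul1r. Qed.

Lemma bounded_operator_sum (I : Type) (r : seq I) (T : I -> H -> H) :
  (forall i, bounded_operator (T i)) ->
  bounded_operator (fun x => \sum_(i <- r) T i x).
Proof.
move=> bT; elim: r => [|i r IH].
  split=> [a x y|]; first by rewrite !big_nil scaler0 addr0.
  by exists 0 => x; rewrite big_nil normr0 mul0r.
rewrite (_ : (fun x => _) = fun x => T i x + \sum_(j <- r) T j x).
  exact: bounded_operatorD.
by apply/funext => x; rewrite big_cons.
Qed.

Lemma invertible_operatorZ (c : K) (T : H -> H) : c != 0 -> linear T ->
  invertible_operator T -> invertible_operator (fun x => c *: T x).
Proof.
move=> c0 lT [S [bS TS ST]]; exists (fun x => c^-1 *: S x).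
have lin_scale (U : H -> H) a x : linear U -> U (a *: x) = a *: U x.
  move=> lU; have U0 : U 0 = 0.
    by have := lU (-1) 0 0; rewrite scaleN1r addNr scaleN1r addNr.
  by have := lU a x 0; rewrite !addr0 U0 addr0.
split; first exact: bounded_operatorZ.
  move=> x; rewrite lin_scale; last by case: bS.
  by rewrite TS scalerA mulVf// scale1r.
by move=> x; rewrite lin_scale// ST scalerA mulfV// scale1r.
Qed.

End BoundedOperators.

Section ProjectiveSpectrum.
Variables (K : numFieldType) (H : normedModType K) (G : Type) (n : nat).
Variables (rho : G -> H -> H) (g : 'I_n -> G).

(* [z 0 ord0] is z_0 and [z 0 (lift ord0 i)] is the coefficient of the
   generator [g i], i.e. z_(i+1) since 'I_n starts at 0. *)
Definition pencil (z : 'rV[K]_n.+1) : H -> H :=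
  fun x => z 0 ord0 *: x + \sum_(i < n) z 0 (lift ord0 i) *: rho (g i) x.

Definition projective_spectrum : set (projective_space K n) :=
  [set p : projective_space K n | ~ invertible_operator (pencil (val (repr p)))].

Hypothesis rho_bounded : forall h, bounded_operator (rho h).

Lemma pencil_bounded z : bounded_operator (pencil z).
Proof.
apply: bounded_operatorD; first exact/bounded_operatorZ/bounded_operator_id.
by apply: bounded_operator_sum => i; apply: bounded_operatorZ.
Qed.

Lemma pencilZ c z x : pencil (c *: z) x = c *: pencil z x.
Proof.
rewrite /pencil mxE scalerDr scaler_sumr scalerA; congr (_ + _).
by apply: eq_bigr => i _; rewrite mxE scalerA.
Qed.

(* Membership does not depend on the representative. *)
Lemma projective_spectrumP (z : homogeneous_coordinates K n) :
  projective_spectrum (\pi z) <-> ~ invertible_operator (pencil (val z)).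
Proof.
rewrite /projective_spectrum/=; have [c c0 ->] := repr_proportional z.
have E : pencil (c *: val z) = fun x => c *: pencil (val z) x.
  by apply/funext => x; exact: pencilZ.
have [lz _] := pencil_bounded (val z).
split; apply: contra_not; rewrite E; first exact: invertible_operatorZ.
move=> h.
have -> : pencil (val z) = fun x => c^-1 *: (c *: pencil (val z) x).
  by apply/funext => x; rewrite scalerA mulVf// scale1r.
apply: invertible_operatorZ; [by rewrite invr_eq0| |exact: h].
by have [] := bounded_operatorZ c (pencil_bounded (val z)).
Qed.

End ProjectiveSpectrum.

Section SquareSummable.
Variables (R : realType) (T : choiceType).
Implicit Types f g : T -> R[i]^o.

Definition sum_sqr f : \bar R := \esum_(x in setT) (normc (f x) ^+ 2)%:E.

Lemma sum_sqr_ge0 f : (0 <= sum_sqr f)%E.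
Proof. by apply: esum_ge0 => x _; rewrite lee_fin sqr_ge0. Qed.

Lemma normc_ge0 (z : R[i]) : 0 <= normc z.
Proof. by case: z => a b; exact: sqrtr_ge0. Qed.

Lemma ge0_esumZl_le (c : R) (a : T -> \bar R) : 0 <= c ->
  (forall x, (0 <= a x)%E) ->
  (\esum_(x in setT) (c%:E * a x) <= c%:E * \esum_(x in setT) a x)%E.
Proof.
move=> c0 a0; apply: ge_ereal_sup => _ [X [finX XT]] <-.
rewrite -ge0_mule_fsumr//; apply: lee_wpmul2l; first by rewrite lee_fin.
by apply: esum_ge; exists X.
Qed.

Lemma sum_sqrD_le (t : R) f g : 0 < t ->
  (sum_sqr (f + g)%R
    <= (1 + t)%:E * sum_sqr f + (1 + t^-1)%:E * sum_sqr g)%E.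
Proof.
move=> t0; have ti0 : 0 < t^-1 by rewrite invr_gt0.
have e0 (h : T -> R[i]^o) x : (0 <= (normc (h x) ^+ 2)%:E)%E.
  by rewrite lee_fin sqr_ge0.
apply: (@le_trans _ _ (\esum_(x in setT)
  ((1 + t)%:E * (normc (f x) ^+ 2)%:E + (1 + t^-1)%:E * (normc (g x) ^+ 2)%:E)))%E.
  apply: le_esum => x _; rewrite -!EFinM -EFinD lee_fin.
  have := @le_normcD R (f x) (g x); have := normc_ge0 (f x + g x).
  rewrite -[(f + g) x]/(f x + g x).
  move: (normc (f x + g x)) (normc (f x)) (normc (g x)) => u a b u0 uab.
  have u2 : u ^+ 2 <= (a + b) ^+ 2.
    by rewrite ler_sqr ?nnegrE// (le_trans u0).
  have -> : (1 + t) * a ^+ 2 + (1 + t^-1) * b ^+ 2 =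
      (a + b) ^+ 2 + t * (a - t^-1 * b) ^+ 2.
    by field; rewrite gt_eqF.
  by rewrite (le_trans u2)// lerDl mulr_ge0 ?sqr_ge0// ltW.
rewrite esumD; last 2 first.
- by move=> x _; rewrite mule_ge0// lee_fin addr_ge0// ltW.
- by move=> x _; rewrite mule_ge0// lee_fin addr_ge0// ltW.
by apply: leeD; apply: ge0_esumZl_le => //; rewrite addr_ge0// ltW.
Qed.

Lemma sum_sqrZ_le (c : R[i]) f :
  (sum_sqr (c *: f) <= (normc c ^+ 2)%:E * sum_sqr f)%E.
Proof.
apply: le_trans; last first.
  by apply: ge0_esumZl_le; rewrite ?sqr_ge0// => x; rewrite lee_fin sqr_ge0.
apply: le_esum => x _.
by rewrite -[(c *: f) x]/(c * f x) normcM exprMn EFinM.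
Qed.

Definition square_summable : {pred T -> R[i]^o} :=
  mem [set f | (sum_sqr f < +oo)%E].

Lemma square_summableP f : reflect (sum_sqr f < +oo)%E (f \in square_summable).
Proof. by apply: (iffP idP); rewrite inE. Qed.

Lemma square_summable_submod : submod_closed square_summable.
Proof.
split=> [|c f g /square_summableP hf /square_summableP hg]; apply/square_summableP.
  by rewrite /sum_sqr esum1 ?ltry// => x _; rewrite normc0 expr0n.
rewrite (le_lt_trans (sum_sqrD_le _ _ ltr01))// lte_add_pinfty//.
  rewrite lte_mul_pinfty ?lee_fin ?addr_ge0//.
  rewrite (le_lt_trans (sum_sqrZ_le _ _))//.
  by rewrite lte_mul_pinfty ?lee_fin ?sqr_ge0.
by rewrite lte_mul_pinfty ?lee_fin ?addr_ge0// invr_ge0.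
Qed.

HB.instance Definition _ :=
  GRing.isSubmodClosed.Build _ _ square_summable square_summable_submod.

Record l2 := L2 { l2_fun :> T -> R[i]^o ; _ : l2_fun \in square_summable }.

HB.instance Definition _ := [isSub for l2_fun].
HB.instance Definition _ := [Choice of l2 by <:].
HB.instance Definition _ := [SubChoice_isSubLmodule of l2 by <:].

(* The norm of a normed space over R[i] takes its values in R[i]. *)
Definition l2_norm (f : l2) : R[i] := (Num.sqrt (fine (sum_sqr f)))%:C.

Lemma l2_fin (f : l2) : sum_sqr f \is a fin_num.
Proof.
rewrite ge0_fin_numE ?sum_sqr_ge0//; apply/square_summableP.
by case: f.
Qed.

Lemma fine_sum_sqr (f : l2) : (fine (sum_sqr f))%:E = sum_sqr f.
Proof. by rewrite fineK// l2_fin. Qed.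

Lemma fine_sum_sqr_ge0 (f : l2) : 0 <= fine (sum_sqr f).
Proof. exact/fine_ge0/sum_sqr_ge0. Qed.

Lemma l2_norm_eq0 (f : l2) : l2_norm f = 0 -> f = 0.
Proof.
move=> [] /eqP; rewrite sqrtr_eq0 => f0.
have {f0} : sum_sqr f = 0%E.
  rewrite -[LHS]fine_sum_sqr; congr EFin; apply/eqP.
  by rewrite eq_le f0 fine_sum_sqr_ge0.
move=> f0; apply/val_inj/funext => x; apply: eq0_normc; apply/eqP.
rewrite -sqrf_eq0 eq_le sqr_ge0 andbT -lee_fin -[leRHS]f0.
apply: esum_ge; exists [set x]; first by split.
by rewrite fsbig_set1.
Qed.

Lemma l2_normZ_le (c : R[i]) (f : l2) : l2_norm (c *: f) <= `|c| * l2_norm f.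
Proof.
rewrite /l2_norm -[`|c|]/((normc c)%:C) -rmorphM/= lecR.
have -> : normc c = Num.sqrt (normc c ^+ 2).
  by rewrite sqrtr_sqr ger0_norm ?normc_ge0.
rewrite -sqrtrM ?sqr_ge0//; apply: ler_wsqrtr.
rewrite -lee_fin EFinM (fine_sum_sqr (c *: f)) (fine_sum_sqr f).
exact: sum_sqrZ_le.
Qed.

Lemma l2_normZ (c : R[i]) (f : l2) : l2_norm (c *: f) = `|c| * l2_norm f.
Proof.
apply/le_anti; rewrite l2_normZ_le/=.
have [->|c0] := eqVneq c 0.
  by rewrite normr0 mul0r scale0r /l2_norm lecR sqrtr_ge0.
have := l2_normZ_le c^-1 (c *: f).
rewrite scalerA mulVf// scale1r normfV => h.
by rewrite -ler_pdivlMl ?normr_gt0.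
Qed.

Lemma l2_normD (f g : l2) : l2_norm (f + g) <= l2_norm f + l2_norm g.
Proof.
have [f0|f0] := eqVneq (l2_norm f) 0.
  by rewrite f0 (l2_norm_eq0 f0) !add0r.
have [g0|g0] := eqVneq (l2_norm g) 0.
  by rewrite g0 (l2_norm_eq0 g0) !addr0.
move: f0 g0; rewrite /l2_norm -rmorphD/= lecR.
set a := Num.sqrt _; set b := Num.sqrt (fine (sum_sqr g)).
rewrite (inj_eq (@complexI R)) (inj_eq (@complexI R)) => a0 b0.
have {}a0 : 0 < a by rewrite lt_def a0 sqrtr_ge0.
have {}b0 : 0 < b by rewrite lt_def b0 sqrtr_ge0.
have -> : a + b = Num.sqrt ((a + b) ^+ 2).
  by rewrite sqrtr_sqr ger0_norm// addr_ge0 ?ltW.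
apply: ler_wsqrtr.
rewrite -lee_fin (fine_sum_sqr (f + g)).
apply: (le_trans (sum_sqrD_le _ _ (divr_gt0 b0 a0))).
rewrite -(fine_sum_sqr f) -(fine_sum_sqr g).
rewrite -[fine (sum_sqr f)]sqr_sqrtr ?fine_sum_sqr_ge0//.
rewrite -[fine (sum_sqr g)]sqr_sqrtr ?fine_sum_sqr_ge0// -/a -/b.
rewrite -!EFinM -EFinD lee_fin le_eqVlt; apply/orP; left; apply/eqP.
by field; rewrite !gt_eqF.
Qed.

HB.instance Definition _ :=
  Lmodule_isNormed.Build R[i] l2 l2_normD l2_normZ l2_norm_eq0.

End SquareSummable.

Arguments l2 R T : clear implicits.

Section RegularRepresentation.
Variables (R : realType) (G : groupType).

Lemma sum_sqr_translate (g : G) (f : G -> R[i]^o) :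
  sum_sqr (fun x => f (g^-1 * x)%g) = sum_sqr f.
Proof.
rewrite /sum_sqr [RHS](@reindex_esum R G G setT setT (fun x => g^-1 * x)%g)//.
split=> //; first by move=> x y _ _; exact: mulgI.
by move=> y _; exists (g * y)%g; rewrite // mulKg.
Qed.

Lemma translate_square_summable (g : G) (f : l2 R G) :
  (fun x => f (g^-1 * x)%g) \in @square_summable R G.
Proof.
by apply/square_summableP; rewrite sum_sqr_translate; apply/square_summableP; case: f.
Qed.

Definition left_regular (g : G) (f : l2 R G) : l2 R G :=
  L2 (translate_square_summable g f).

Lemma left_regularE g f x : left_regular g f x = f (g^-1 * x)%g.
Proof. by []. Qed.

Lemma left_regular1 f : left_regular 1%g f = f.
Proof. by apply/val_inj/funext => x /=; rewrite invg1 mul1g. Qed.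

Lemma left_regularM g h f :
  left_regular (g * h)%g f = left_regular g (left_regular h f).
Proof. by apply/val_inj/funext => x /=; rewrite invgM mulgA. Qed.

Lemma left_regular_isometry g f : `|left_regular g f| = `|f|.
Proof. by rewrite /Num.norm/= /l2_norm/= sum_sqr_translate. Qed.

Lemma left_regular_bounded g : bounded_operator (left_regular g).
Proof.
split; first by move=> a f h; apply/val_inj/funext.
by exists 1 => f; rewrite mul1r left_regular_isometry.
Qed.

End RegularRepresentation.

Section Amenability.
Variables (R : realType) (G : groupType).

(* G is discrete, so L^oo(G) is the space of all bounded functions. *)
Definition bounded_function : {pred G -> R[i]^o} :=
  mem [set f : G -> R[i]^o | exists M : R[i], forall x, `|f x| <= M].

Lemma bounded_functionP (f : G -> R[i]^o) :
  reflect (exists M : R[i], forall x, `|f x| <= M) (f \in bounded_function).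
Proof. by apply: (iffP idP); rewrite inE. Qed.

Lemma bounded_function_submod : submod_closed bounded_function.
Proof.
split=> [|c f g /bounded_functionP[M fM] /bounded_functionP[N gN]];
    apply/bounded_functionP.
  by exists 0 => x; rewrite normr0.
exists (`|c| * M + N) => x; rewrite (le_trans (ler_normD _ _))// lerD//.
by rewrite normrZ ler_wpM2l.
Qed.

HB.instance Definition _ :=
  GRing.isSubmodClosed.Build _ _ bounded_function bounded_function_submod.

Record linfty := Linfty {
  linfty_fun :> G -> R[i]^o ;
  _ : linfty_fun \in bounded_function }.

HB.instance Definition _ := [isSub for linfty_fun].
HB.instance Definition _ := [Choice of linfty by <:].
HB.instance Definition _ := [SubChoice_isSubLmodule of linfty by <:].

Lemma one_bounded_function : (fun=> 1 : R[i]^o) \in bounded_function.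
Proof. by apply/bounded_functionP; exists `|1|. Qed.

Definition linfty1 : linfty := Linfty one_bounded_function.

Lemma translate_bounded_function (g : G) (f : linfty) :
  (fun x => f (g^-1 * x)%g) \in bounded_function.
Proof.
case: f => f /= /bounded_functionP[M fM].
by apply/bounded_functionP; exists M => x.
Qed.

Definition translate (g : G) (f : linfty) : linfty :=
  Linfty (translate_bounded_function g f).

(* In R[i], [0 <= z] means that z is real and nonnegative. *)
Definition is_state (phi : {scalar linfty}) : Prop :=
  (forall f : linfty, (forall x, 0 <= f x) -> 0 <= phi f) /\ phi linfty1 = 1.

Definition amenable : Prop :=
  exists2 phi : {scalar linfty},
    is_state phi & forall (g : G) (f : linfty), phi (translate g f) = phi f.

End Amenability.

(* The generators need not be distinct or nontrivial. *)
Definition generates (G : groupType) (n : nat) (g : 'I_n -> G) : Prop :=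
  forall S : {pred G},
    group_closed S -> (forall i, g i \in S) -> forall x, x \in S.

(* Main.v *)
Require Import Defs.
From HB Require Import structures.
From mathcomp Require Import all_boot all_order all_algebra.
From mathcomp Require Import complex finmap.
From mathcomp Require Import all_classical all_reals all_analysis.
From mathcomp Require Import ring lra.

(** Both conditions are negations of a spectral gap: a constant C with
    ||u||^2 <= C sum_i ||g_i u - u||^2 in l2(G).

    On H_0 the pencil is A(z) = sum_i z_i (lambda(g_i) - 1), so an invertible
    A(z) gives a gap.  Conversely a gap makes the lazy walk
    T = 1/2 + (2n)^-1 sum_i lambda(g_i) a strict contraction of l2(G), so
    1 - T, which is A(z) for some z in H_0, is inverted by its Neumann series.

    Without a gap, the means f |-> sum f u^2 / ||u||^2 for almost invariant u
    converge along an ultrafilter to an invariant mean.  With a gap, the Green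
    function of t T, for the symmetrized generators S and some t > 1, is a
    positive v with sum_(s in S) v(s x) <= (#S - e) v(x).  The functions
    log (v(s x) / v(x)) are bounded and add up to at most - e, but an invariant
    mean takes opposite values at those of s and s^-1, whence 0 <= - e. *)

Set Implicit Arguments.
Unset Strict Implicit.
Unset Printing Implicit Defensive.

Import Order.TTheory GRing.Theory Num.Theory.
Import numFieldNormedType.Exports Normc.

Local Open Scope classical_set_scope.
Local Open Scope ring_scope.
Local Open Scope complex_scope.

(** * Square norms of real functions *)

Section SquareNorm.
Variables (R : realType) (G : groupType).
Implicit Types u v : G -> R.

Definition sqnorm u : \bar R := \esum_(x in setT) (u x ^+ 2)%:E.

Lemma sqnorm_ge0 u : (0 <= sqnorm u)%E.
Proof. by apply: esum_ge0 => x _; rewrite lee_fin sqr_ge0. Qed.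

Lemma normc_real (r : R) : normc r%:C = `|r|.
Proof. by rewrite /= expr0n addr0 sqrtr_sqr. Qed.

Lemma sqr_normc_real (r : R) : normc r%:C ^+ 2 = r ^+ 2.
Proof. by rewrite normc_real real_normK ?num_real. Qed.

Lemma sqnormE u : sqnorm u = sum_sqr (fun x => (u x)%:C).
Proof. by apply: eq_esum => x _; rewrite sqr_normc_real. Qed.

Lemma sqnorm_translate h u : sqnorm (fun x => u (h^-1 * x)%g) = sqnorm u.
Proof. by rewrite !sqnormE (sum_sqr_translate h (fun x => (u x)%:C)). Qed.

Lemma le_sqnorm u v : (forall x, `|u x| <= `|v x|) -> (sqnorm u <= sqnorm v)%E.
Proof.
move=> uv; apply: le_esum => x _; rewrite lee_fin.
by rewrite -(real_normK (num_real (u x))) -(real_normK (num_real (v x))) lerXn2r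
  ?nnegrE.
Qed.

(** The free weight [t] lets the coefficient of either term come as close to 1 as desired. *)
Lemma sqnormD_le (t : R) u v : 0 < t ->
  (sqnorm (fun x => u x + v x)%R
    <= (1 + t)%:E * sqnorm u + (1 + t^-1)%:E * sqnorm v)%E.
Proof.
move=> t0; rewrite !sqnormE; apply: le_trans (sum_sqrD_le _ _ t0).
by apply: le_esum => x _; rewrite rmorphD; exact: lexx.
Qed.

Lemma sqnormZ_le (c : R) u :
  (sqnorm (fun x => c * u x)%R <= (c ^+ 2)%:E * sqnorm u)%E.
Proof.
by apply: le_trans (ge0_esumZl_le _ _) => //; rewrite ?sqr_ge0//;
  [apply: le_esum => x _; rewrite exprMn|move=> x; rewrite lee_fin sqr_ge0].
Qed.

Lemma sqnorm_linear_lty (c : R) u v :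
  (sqnorm u < +oo -> sqnorm v < +oo -> sqnorm (fun x => c * u x + v x)%R < +oo)%E.
Proof.
move=> uy vy; apply: (le_lt_trans (sqnormD_le _ _ ltr01)).
rewrite lte_add_pinfty// lte_mul_pinfty ?lee_fin ?addr_ge0 ?invr_ge0//.
apply: (le_lt_trans (sqnormZ_le _ _)).
by rewrite lte_mul_pinfty ?lee_fin ?sqr_ge0.
Qed.

Lemma sqr_le_sqnorm u x : ((u x ^+ 2)%:E <= sqnorm u)%E.
Proof. by apply: esum_ge; exists [set x]; rewrite ?fsbig_set1. Qed.

Lemma sqnorm_fin_support u : finite_set [set x | u x != 0] ->
  (sqnorm u < +oo)%E.
Proof.
move=> fu; rewrite (_ : sqnorm u = \esum_(x in [set x | u x != 0%R]) (u x ^+ 2)%:E)%E.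
  rewrite esum_fset//; last by move=> x _; rewrite lee_fin sqr_ge0.
  by rewrite fsumEFin// ltry.
rewrite [RHS]esum_mkcond; apply: eq_esum => x _; case: ifPn => //.
by rewrite notin_setE/= => /negP; rewrite negbK => /eqP->; rewrite expr0n.
Qed.

End SquareNorm.

(** Cauchy-Schwarz, read off from sum_j (m a_j - s)^2 >= 0, where m = #|J| and s is the sum of the
    a_j. *)
Lemma sqr_sum_le (R : realFieldType) (J : finType) (a : J -> R) :
  (\sum_j a j) ^+ 2 <= #|J|%:R * \sum_j a j ^+ 2.
Proof.
have [J0|J0] := posnP #|J|.
  by rewrite big1 ?expr0n ?J0 ?mul0r// => j; have := card0_eq J0 j; rewrite inE.
have m0 : 0 < #|J|%:R :> R by rewrite ltr0n.
set m := #|J|%:R in m0 *; set s := \sum_j a j.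
have : 0 <= \sum_j (m * a j - s) ^+ 2 by apply: sumr_ge0 => j _; exact: sqr_ge0.
have -> : \sum_j (m * a j - s) ^+ 2 =
    m ^+ 2 * (\sum_j a j ^+ 2) - 2 * m * s * s + m * s ^+ 2.
  transitivity (\sum_j (m ^+ 2 * a j ^+ 2 + - (2 * m * s) * a j + s ^+ 2)).
    by apply: eq_bigr => j _; ring.
  by rewrite !big_split/= sumr_const -!mulr_sumr -/s -[s ^+ 2 *+ _]mulr_natl -/m; ring.
have -> : m ^+ 2 * (\sum_j a j ^+ 2) - 2 * m * s * s + m * s ^+ 2 =
  m * (m * (\sum_j a j ^+ 2) - s ^+ 2) by ring.
by rewrite pmulr_rge0// subr_ge0.
Qed.

Lemma esum_EFinZl (R : realType) (T : choiceType) (a : R) (b : T -> R) :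
  0 <= a -> (forall x, 0 <= b x) ->
  (\esum_(x in setT) (a * b x)%:E = a%:E * \esum_(x in setT) (b x)%:E)%E.
Proof.
move=> + b0; under eq_esum do rewrite EFinM.
rewrite le_eqVlt => /predU1P[<-|a0].
  by rewrite mul0e esum1// => x _; rewrite mul0e.
apply/eqP; rewrite eq_le; apply/andP; split.
  by apply: ge0_esumZl_le => [|x]; rewrite ?lee_fin// ltW.
rewrite -lee_pdivlMl//; apply: le_trans (ge0_esumZl_le _ _).
- by apply: le_esum => x _; rewrite muleA -EFinM mulVf ?gt_eqF// mul1r.
- by rewrite invr_ge0 ltW.
- by move=> x; apply: mule_ge0; rewrite lee_fin// ltW.
Qed.

(** * Spectral gap and contraction of the lazy walk *)

Section Walk.
Variables (R : realType) (G : groupType) (J : finType) (h : J -> G).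
Implicit Types u v : G -> R.

(* Testing finitely supported nonnegative functions suffices: see
   [lazy_walk_contract]. *)
Definition spectral_gap := exists C : R, forall u : G -> R,
  finite_set [set x | u x != 0] -> (forall x, 0 <= u x) ->
  (sqnorm u <= C%:E * \sum_j sqnorm (fun x => u ((h j)^-1 * x)%g - u x)%R)%E.

(** The weights stay free because the Neumann series serves both the lazy walk and a multiple t > 1
    of it. *)
Definition walk (c d : R) u : G -> R :=
  fun x => c * u x + d * \sum_j u ((h j)^-1 * x)%g.

Lemma walk_linear c d (a : R) u v :
  walk c d (fun x => a * u x + v x) = (fun x => a * walk c d u x + walk c d v x).
Proof.
by apply/funext => x; rewrite /walk big_split/= -mulr_sumr; ring.
Qed.

Lemma le_walk c d u v : 0 <= c -> 0 <= d -> (forall x, u x <= v x) ->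
  forall x, walk c d u x <= walk c d v x.
Proof.
by move=> c0 d0 uv x; rewrite lerD// ler_wpM2l// ler_sum.
Qed.

Lemma walk_ge0 c d u : 0 <= c -> 0 <= d -> (forall x, 0 <= u x) ->
  forall x, 0 <= walk c d u x.
Proof.
by move=> c0 d0 u0 x; rewrite addr_ge0// mulr_ge0// sumr_ge0.
Qed.

Lemma norm_walk_le c d u x : 0 <= c -> 0 <= d ->
  `|walk c d u x| <= walk c d (fun y => `|u y|) x.
Proof.
move=> c0 d0; rewrite (le_trans (ler_normD _ _))// !normrM (ger0_norm c0) (ger0_norm d0).
by rewrite lerD// ler_wpM2l// ler_norm_sum.
Qed.

Local Notation m := (#|J|%:R : R).

Definition lazy_walk := walk 2^-1 (2 * m)^-1.

(** Convexity of the square with an explicit defect: right side minus left side is (4 m^2)^-1 (m q -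
    s^2), with s and q the sums of the neighbouring values and of their squares; Cauchy-Schwarz
    makes it nonnegative. *)
Lemma lazy_walk_variance u x : (0 < #|J|)%N ->
  lazy_walk u x ^+ 2 + (4 * m)^-1 * \sum_j (u ((h j)^-1 * x)%g - u x) ^+ 2 <=
  2^-1 * u x ^+ 2 + (2 * m)^-1 * \sum_j u ((h j)^-1 * x)%g ^+ 2.
Proof.
move=> J0; have m0 : 0 < m by rewrite ltr0n.
have := sqr_sum_le (fun j => u ((h j)^-1 * x)%g).
rewrite /lazy_walk /walk.
have -> : \sum_j (u ((h j)^-1 * x)%g - u x) ^+ 2 =
    \sum_j u ((h j)^-1 * x)%g ^+ 2 - 2 * u x * (\sum_j u ((h j)^-1 * x)%g)
    + m * u x ^+ 2.
  transitivity (\sum_j (u ((h j)^-1 * x)%g ^+ 2 +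
      - (2 * u x) * u ((h j)^-1 * x)%g + u x ^+ 2)).
    by apply: eq_bigr => j _; ring.
  rewrite !big_split/= sumr_const -!mulr_sumr -[u x ^+ 2 *+ _]mulr_natl.
  by ring.
move: (\sum_j _) (\sum_j _ ^+ 2) (u x) m0 => s q a m0 sq.
rewrite -subr_ge0.
have -> : 2^-1 * a ^+ 2 + (2 * m)^-1 * q -
    ((2^-1 * a + (2 * m)^-1 * s) ^+ 2 + (4 * m)^-1 * (q - 2 * a * s + m * a ^+ 2))
  = (4 * m ^+ 2)^-1 * (m * q - s ^+ 2).
  by field; rewrite gt_eqF.
by rewrite mulr_ge0 ?subr_ge0// invr_ge0 mulr_ge0 ?sqr_ge0.
Qed.

(** For empty [J] the gap would bound the norm of the point mass at 1 by an empty sum. *)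
Lemma spectral_gap_card : spectral_gap -> (0 < #|J|)%N.
Proof.
move=> [C hC]; rewrite lt0n; apply/negP => /eqP J0.
pose u (x : G) : R := (x == 1%g)%:R.
have fu : finite_set [set x | u x != 0].
  apply: (@sub_finite_set _ _ [set 1%g]) => // x; rewrite /u/=.
  by case: (x =P 1%g) => //= _ /eqP.
have := hC u fu (fun x => ler0n _ _).
rewrite big1 ?mule0; last by move=> j; have := card0_eq J0 j; rewrite inE.
move=> /(le_trans (sqr_le_sqnorm u 1%g)); rewrite /u eqxx expr1n.
by rewrite lee_fin ler10.
Qed.

(** Sum [lazy_walk_variance] over x: translations preserve the square norm, so the weights 1/2 and m
    / (2 m) add up to 1. *)
Lemma sqnorm_lazy_walk_le u : (0 < #|J|)%N ->
  (sqnorm (lazy_walk u) +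
    (4 * m)^-1%:E * \sum_j sqnorm (fun x => u ((h j)^-1 * x)%g - u x)%R
    <= sqnorm u)%E.
Proof.
move=> J0; have m0 : 0 < m by rewrite ltr0n.
have e0 (v : G -> R) x : (0 <= (v x ^+ 2)%:E)%E by rewrite lee_fin sqr_ge0.
have esS (v : J -> G -> R) : (\sum_j sqnorm (v j) =
    \esum_(x in setT) (\sum_j v j x ^+ 2)%:E)%E.
  rewrite -esum_sum; first by apply: eq_esum => x _; rewrite sumEFin.
  by move=> x j _ _; exact: e0.
have S0 (v : J -> R) : 0 <= \sum_j v j ^+ 2.
  by apply: sumr_ge0 => j _; exact: sqr_ge0.
have i2 : 0 <= (2 * m)^-1 :> R by rewrite invr_ge0 mulr_ge0// ltW.
have i4 : 0 <= (4 * m)^-1 :> R by rewrite invr_ge0 mulr_ge0// ltW.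
rewrite esS -esum_EFinZl// -esumD//; last by move=> x _; rewrite lee_fin mulr_ge0.
apply: (@le_trans _ _ (\esum_(x in setT) ((2^-1 * u x ^+ 2)%:E +
    ((2 * m)^-1 * \sum_j u ((h j)^-1 * x)%g ^+ 2)%:E))%E).
  by apply: le_esum => x _; rewrite -!EFinD lee_fin lazy_walk_variance.
rewrite esumD//; last 2 first.
- by move=> x _; rewrite lee_fin mulr_ge0// sqr_ge0.
- by move=> x _; rewrite lee_fin mulr_ge0.
rewrite esum_EFinZl//; last by move=> x; exact: sqr_ge0.
rewrite esum_EFinZl// -esS (eq_bigr (fun=> sqnorm u)); last first.
  by move=> j _; exact: sqnorm_translate.
rewrite -/(sqnorm u).
have [/eqP uy|] := eqVneq (sqnorm u) +oo%E; first by rewrite (eqP uy) leey.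
rewrite -ltey => uy; have /fineK <- : sqnorm u \is a fin_num.
  by rewrite ge0_fin_numE ?sqnorm_ge0.
rewrite sumEFin sumr_const -!EFinM -EFinD lee_fin.
rewrite -[fine _ *+ _]mulr_natl le_eqVlt; apply/orP; left; apply/eqP.
by field; rewrite gt_eqF.
Qed.

End Walk.

Section Contraction.
Variables (R : realType) (G : groupType) (J : finType) (h : J -> G).
Implicit Types u v : G -> R.

Local Notation m := (#|J|%:R : R).

(** By the gap, the defect in [sqnorm_lazy_walk_le] is at least the fraction 1 / (4 m D) of the
    square norm of u. Taking D = max (C, 1) keeps b = 1 - 1 / (4 m D) in [0, 1). *)
Lemma lazy_walk_contract_fin : spectral_gap R h ->
  exists2 b : R, 0 <= b < 1 & forall u, finite_set [set x | u x != 0] ->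
    (forall x, 0 <= u x) -> (sqnorm (lazy_walk h u) <= b%:E * sqnorm u)%E.
Proof.
move=> gap; have J0 := spectral_gap_card gap; have [C hC] := gap.
have m1 : 1 <= m by rewrite ler1n.
pose D := Num.max C 1; have D1 : 1 <= D by rewrite le_max lexx orbT.
have mD1 : 4 <= 4 * m * D by rewrite -mulrA ler_peMr// mulr_ege1.
exists (1 - (4 * m * D)^-1).
  have i0 : 0 < (4 * m * D)^-1 by rewrite invr_gt0; lra.
  have i1 : (4 * m * D)^-1 <= 1 by rewrite invf_le1; lra.
  by apply/andP; split; lra.
move=> u fu u0; have := sqnorm_lazy_walk_le h u J0; have := hC u fu u0.
set S := (\sum_j _)%E; have S0 : (0 <= S)%E.
  by apply: sume_ge0 => j _; exact: sqnorm_ge0.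
have i4 : 0 < (4 * m)^-1 by rewrite invr_gt0; lra.
have := sqnorm_fin_support fu; have := sqnorm_ge0 u.
have := sqnorm_ge0 (lazy_walk h u).
case: (sqnorm u) => [n||]//; case: (sqnorm _) => [t||]//; last first.
  move=> _ _ _ _ tn; exfalso; move: tn; rewrite addye ?leye_eq//.
  by rewrite gt_eqF// (lt_le_trans ltNy0)// mule_ge0// lee_fin ltW.
move: S0; case: S => [s||]//; last first.
  by move=> _ _ _ _ _; rewrite gt0_muley ?lte_fin// addey// leye_eq.
rewrite -!EFinM -EFinD !lee_fin => s0 t0 n0 _ nC tn.
have nD : n <= D * s.
  by rewrite (le_trans nC)// ler_wpM2r// le_max lexx.
rewrite mulrBl mul1r lerBrDr (le_trans _ tn)// lerD2l.
have -> : (4 * m)^-1 * s = (4 * m * D)^-1 * (D * s).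
  by field; rewrite !gt_eqF//; lra.
by rewrite ler_wpM2l// invr_ge0; lra.
Qed.

(* A walk only sees finitely many values at a time, so the bound on finitely
   supported functions passes to all functions. *)
Lemma lazy_walk_contract : spectral_gap R h ->
  exists2 b : R, 0 <= b < 1 &
    forall u, (sqnorm (lazy_walk h u) <= b%:E * sqnorm u)%E.
Proof.
move=> /lazy_walk_contract_fin[b b01 hb]; exists b => // u.
have i2 : 0 <= (2 * m)^-1 by rewrite invr_ge0 mulr_ge0.
have h2 : 0 <= 2^-1 :> R by rewrite invr_ge0.
apply: ge_ereal_sup => _ [X [finX _]] <-.
(* [Y] holds every point that the walk reads when evaluated on [X], so cutting |u| off outside [Y]
   still dominates the walk of u there. *)
pose Y := X `|` \bigcup_(j in [set: J]) (fun x => (h j)^-1 * x)%g @` X.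
have finY : finite_set Y.
  rewrite finite_setU; split=> //; apply: bigcup_finite => // j _.
  exact: finite_image.
pose w x := if x \in Y then `|u x| else 0.
have w0 x : 0 <= w x by rewrite /w; case: ifP.
have wu x : `|w x| <= `|u x| by rewrite /w; case: ifP; rewrite ?normr_id ?normr0.
have uw x : X x -> `|lazy_walk h u x| <= `|lazy_walk h w x|.
  move=> Xx; rewrite [leRHS]ger0_norm ?walk_ge0//.
  rewrite (le_trans (norm_walk_le _ _ _ _ _))// /lazy_walk /walk.
  have wY y : Y y -> w y = `|u y| by move=> Yy; rewrite /w ifT// inE.
  rewrite wY; last by left.
  rewrite lerD2l ler_wpM2l// ler_sum// => j _; rewrite wY//.
  by right; exists j => //; exists x.
apply: (@le_trans _ _ (\sum_(x \in X) (lazy_walk h w x ^+ 2)%:E)%E).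
  apply: lee_fsum => // x Xx; rewrite lee_fin.
  rewrite -(real_normK (num_real (lazy_walk h u x))).
  by rewrite -(real_normK (num_real (lazy_walk h w x))) lerXn2r ?nnegrE ?uw.
apply: (@le_trans _ _ (sqnorm (lazy_walk h w))); first by apply: esum_ge; exists X.
have fw : finite_set [set x | w x != 0].
  apply: sub_finite_set finY => x; rewrite /w/=; case: ifPn; last by rewrite eqxx.
  by rewrite inE.
apply: (le_trans (hb w fw w0)); apply: lee_wpmul2l.
  by rewrite lee_fin; case/andP: b01.
exact: le_sqnorm.
Qed.

End Contraction.

(** * Neumann series *)

Section Resolvent.
Variables (R : realType) (G : groupType) (J : finType) (h : J -> G).
Variables (c d b : R).
Hypotheses (c0 : 0 <= c) (d0 : 0 <= d) (b01 : 0 <= b < 1).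
Local Notation B := (walk h c d).
Hypothesis Bb : forall u : G -> R, (sqnorm (B u) <= b%:E * sqnorm u)%E.
Implicit Types u v : G -> R.

(** The partial sum u + B u + ... + B^(N-1) u in Horner form. *)
Definition neumann u N : G -> R := iter N (fun v x => u x + B v x) (fun=> 0).

Lemma neumannS u N x : neumann u N.+1 x = u x + B (neumann u N) x.
Proof. by []. Qed.

(* [(a + b) ^ 2 <= (1 + s^-1) a ^ 2 + (1 + s) b ^ 2] with [(1 + s) b < 1] bounds
   the partial sums by induction, without summing norms. *)
Lemma neumann_bound :
  exists2 K : R, 0 <= K & forall u N, (sqnorm (neumann u N) <= K%:E * sqnorm u)%E.
Proof.
have /andP[b0 b1] := b01.
pose s := (1 - b) / 2; have s0 : 0 < s by rewrite /s; lra.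
pose p := (1 + s) * b; have p1 : p < 1 by rewrite /p /s; nra.
have p0 : 0 <= p by rewrite /p mulr_ge0//; lra.
have si0 : 0 < s^-1 by rewrite invr_gt0.
(* [K] solves K = (1 + s^-1) + p K, so the bound reproduces itself in the induction. *)
pose K := (1 + s^-1) / (1 - p).
have K0 : 0 <= K by rewrite /K divr_ge0//; lra.
exists K => // u; elim=> [|N IH].
  rewrite /sqnorm esum1; first by rewrite mule_ge0 ?lee_fin ?sqnorm_ge0.
  by move=> x _; rewrite /= expr0n.
apply: (le_trans (sqnormD_le _ _ si0)); rewrite invrK.
apply: (@le_trans _ _ ((1 + s^-1)%:E * sqnorm u +
    (1 + s)%:E * (b%:E * (K%:E * sqnorm u)))%E).
  apply: leeD => //; apply: lee_wpmul2l; first by rewrite lee_fin; lra.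
  apply: (le_trans (Bb _)); exact: lee_wpmul2l.
rewrite !muleA -!EFinM -ge0_muleDl ?lee_fin; last 2 first.
- by lra.
- by rewrite mulr_ge0.
rewrite -EFinD lee_wpmul2r ?sqnorm_ge0// lee_fin -/p.
by rewrite le_eqVlt; apply/orP; left; apply/eqP; rewrite /K; field; lra.
Qed.

Lemma neumann_linear a u v N :
  neumann (fun x => a * u x + v x) N = (fun x => a * neumann u N x + neumann v N x).
Proof.
elim: N => [|N IH]; apply/funext => x; first by rewrite /= mulr0 addr0.
by rewrite neumannS IH walk_linear !neumannS; ring.
Qed.

Lemma neumann_walk u N : neumann (B u) N = B (neumann u N).
Proof.
elim: N => [|N IH]; apply/funext => x.
  by rewrite /= /walk big1// !mulr0 addr0.
rewrite neumannS IH.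
have := walk_linear h c d 1 u (B (neumann u N)).
have -> : (fun x => 1 * u x + B (neumann u N) x) = neumann u N.+1.
  by apply/funext => y; rewrite mul1r.
by move=> ->; rewrite mul1r.
Qed.

Lemma neumann_ge0 u N : (forall x, 0 <= u x) -> forall x, 0 <= neumann u N x.
Proof.
move=> u0; elim: N => [|N IH] x //; rewrite neumannS addr_ge0//.
exact: walk_ge0.
Qed.

Lemma neumann_nondecreasing u x : (forall x, 0 <= u x) ->
  nondecreasing_seq (neumann u ^~ x).
Proof.
move=> u0; apply/nondecreasing_seqP => N; elim: N x => [|N IH] x.
  exact: neumann_ge0.
by rewrite !neumannS lerD2l; exact: le_walk.
Qed.

(** For u >= 0 the partial sums increase and are bounded at each point by [neumann_bound]; in
    general u is split into its positive and negative parts. *)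
Lemma is_cvg_neumann u x : (sqnorm u < +oo)%E -> cvgn (neumann u ^~ x).
Proof.
have [K K0 hK] := neumann_bound.
have pos v : (forall x, 0 <= v x) -> (sqnorm v < +oo)%E ->
    cvgn (neumann v ^~ x).
  move=> v0 vy; apply: nondecreasing_is_cvgn; first exact: neumann_nondecreasing.
  have vf : sqnorm v \is a fin_num by rewrite ge0_fin_numE ?sqnorm_ge0.
  (* The bound y^2 <= z gives y <= z + 1, which avoids a square root. *)
  exists (K * fine (sqnorm v) + 1) => _ [N _ <-] /=.
  have := le_trans (sqr_le_sqnorm _ x) (hK v N).
  rewrite -(fineK vf) -EFinM lee_fin; have := neumann_ge0 N v0 x.
  by move: (neumann v N x) (K * _) => y z; nra.
move=> uy; pose up x := (`|u x| + u x) / 2; pose un x := (`|u x| - u x) / 2.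
have upE y : `|up y| <= `|u y|.
  by rewrite /up; case: (ger0P (u y)) => uy0; rewrite ger0_norm; lra.
have unE y : `|un y| <= `|u y|.
  by rewrite /un; case: (ger0P (u y)) => uy0; rewrite ger0_norm; lra.
have up0 y : 0 <= up y by rewrite /up; case: (ger0P (u y)); lra.
have un0 y : 0 <= un y by rewrite /un; case: (ger0P (u y)); lra.
have -> : u = fun x => (-1) * un x + up x.
  by apply/funext => y; rewrite /un /up; lra.
rewrite (_ : (fun N => _) = fun N => (-1) * neumann un N x + neumann up N x); last first.
  by apply/funext => N; rewrite neumann_linear.
apply: is_cvgD; last by apply: pos => //; exact: le_lt_trans (le_sqnorm upE) uy.
apply: is_cvgMr; apply: pos => //; exact: le_lt_trans (le_sqnorm unE) uy.
Qed.

(** The values of (1 - B)^-1 u, as a pointwise limit; the l2 bound is recovered in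
    [resolvent_bound]. *)
Definition resolvent u : G -> R := fun x => limn (neumann u ^~ x).

Lemma cvg_neumann u x : (sqnorm u < +oo)%E ->
  neumann u ^~ x @ \oo --> resolvent u x.
Proof. exact: is_cvg_neumann. Qed.

Lemma cvg_walk (v_ : nat -> G -> R) v x : (forall y, v_ ^~ y @ \oo --> v y) ->
  (fun N => B (v_ N) x) @ \oo --> B v x.
Proof.
move=> vv; apply: cvgD; first by apply: cvgMr; exact: vv.
apply: cvgMr; apply: cvg_big => [|j _]; [exact: add_continuous|exact: vv].
Qed.

(** The limit of the recursion [neumannS]; it makes the resolvent a right inverse of 1 - B. *)
Lemma resolventE u x : (sqnorm u < +oo)%E ->
  resolvent u x = u x + B (resolvent u) x.
Proof.
move=> uy; apply/cvg_lim => //; rewrite -cvg_shiftS.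
apply: cvgD; first exact: cvg_cst.
by apply: cvg_walk => y; exact: cvg_neumann.
Qed.

Lemma sqnorm_walk_lty u : (sqnorm u < +oo)%E -> (sqnorm (B u) < +oo)%E.
Proof.
move=> uy; apply: (le_lt_trans (Bb u)).
by rewrite lte_mul_pinfty ?lee_fin//; case/andP: b01.
Qed.

(** Commuting with B makes the resolvent a left inverse of 1 - B as well. *)
Lemma resolvent_walk u : (sqnorm u < +oo)%E -> resolvent (B u) = B (resolvent u).
Proof.
move=> uy; apply/funext => x; apply/cvg_lim => //.
under eq_fun do rewrite neumann_walk.
by apply: cvg_walk => y; exact: cvg_neumann.
Qed.

Lemma resolvent_linear a u v : (sqnorm u < +oo)%E -> (sqnorm v < +oo)%E ->
  resolvent (fun x => a * u x + v x) = fun x => a * resolvent u x + resolvent v x.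
Proof.
move=> uy vy; apply/funext => x; apply/cvg_lim => //.
under eq_fun do rewrite neumann_linear.
by apply: cvgD; [apply: cvgMr|]; exact: cvg_neumann.
Qed.

Lemma resolvent_ge0 u x : (sqnorm u < +oo)%E -> (forall x, 0 <= u x) ->
  0 <= resolvent u x.
Proof.
move=> uy u0; apply: limr_ge; first exact: is_cvg_neumann.
by apply: nearW => N; exact: neumann_ge0.
Qed.

(** Fatou's argument: over a finite set the uniform bound on the partial sums passes to the
    limit. *)
Lemma resolvent_bound : exists2 K : R, 0 <= K & forall u, (sqnorm u < +oo)%E ->
  (sqnorm (resolvent u) <= K%:E * sqnorm u)%E.
Proof.
have [K K0 hK] := neumann_bound; exists K => // u uy.
apply: ge_ereal_sup => _ [X [finX _]] <-.
have uf : sqnorm u \is a fin_num by rewrite ge0_fin_numE ?sqnorm_ge0.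
have cvgX : (fun N => \sum_(x <- fset_set X) neumann u N x ^+ 2) @ \oo -->
    \sum_(x <- fset_set X) resolvent u x ^+ 2.
  apply: cvg_big => [|x _]; first exact: add_continuous.
  by apply: cvgM; exact: cvg_neumann.
rewrite fsbig_finite//= sumEFin -(fineK uf) -EFinM lee_fin.
apply: (cvgr_to_le cvgX); apply: nearW => N.
rewrite -lee_fin EFinM (fineK uf) (le_trans _ (hK u N))// -sumEFin.
by rewrite -fsbig_finite//; apply: esum_ge; exists X.
Qed.

Lemma le_resolvent u x : (sqnorm u < +oo)%E -> (forall x, 0 <= u x) ->
  u x <= resolvent u x.
Proof.
move=> uy u0; rewrite [leRHS]resolventE// lerDl walk_ge0// => y.
exact: resolvent_ge0.
Qed.

End Resolvent.

(** * A spectral gap excludes invariant means *)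

Section NotAmenable.
Variables (R : realType) (G : groupType) (n : nat) (g : 'I_n -> G).

Definition symmetrized (j : 'I_n + 'I_n) : G :=
  match j with inl i => g i | inr i => (g i)^-1%g end.

(** Further generators only enlarge the right side once the constant is nonnegative, hence max (C,
    0). *)
Lemma spectral_gap_symmetrized : spectral_gap R g -> spectral_gap R symmetrized.
Proof.
move=> [C hC]; exists (Num.max C 0) => u fu u0; apply: (le_trans (hC u fu u0)).
have S0 (v : 'I_n -> G -> R) : (0 <= \sum_i sqnorm (v i))%E.
  by apply: sume_ge0 => i _; exact: sqnorm_ge0.
apply: (@le_trans _ _
  ((Num.max C 0)%:E * \sum_i sqnorm (fun x => u ((g i)^-1 * x)%g - u x)%R)%E).
  by rewrite lee_wpmul2r// lee_fin le_max lexx.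
apply: lee_wpmul2l; first by rewrite lee_fin le_max lexx orbT.
by rewrite big_sumType/= leeDl.
Qed.

(* A multiple [t > 1] of the lazy walk is still a strict contraction of l2;
   its Green function [v] satisfies [v >= t * lazy_walk v]. *)
Lemma positive_supersolution : generates g -> spectral_gap R g ->
  exists v : G -> R, exists2 e : R, 0 < e & (forall x, 0 < v x) /\
  forall x, \sum_i (v ((g i)^-1 * x)%g + v (g i * x)%g) <= ((n + n)%:R - e) * v x.
Proof.
move=> gen /spectral_gap_symmetrized gap.
have := spectral_gap_card gap; have [b /andP[b0 b1] hb] := lazy_walk_contract gap.
set m : R := #|{: 'I_n + 'I_n}|%:R.
have mE : m = (n + n)%:R by rewrite /m card_sum card_ord.
rewrite -(ltr0n R) -/m => m0.
(* As b = 1 - 4 s, the factor t^2 b = (1 + s)^2 (1 - 4 s) stays below 1. *)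
pose s := (1 - b) / 4; have s0 : 0 < s by rewrite /s; lra.
pose t := 1 + s; have t1 : 1 < t by rewrite /t; lra.
pose c := t * 2^-1; pose d := t * (2 * m)^-1.
have d0 : 0 < d by rewrite /d mulr_gt0 ?invr_gt0 ?mulr_gt0//; lra.
have c0 : 0 < c by rewrite /c; lra.
have cd u : walk symmetrized c d u = fun x => t * lazy_walk symmetrized u x.
  by apply/funext => x; rewrite /lazy_walk /walk -/m mulrDr !mulrA.
have tb01 : 0 <= t ^+ 2 * b < 1.
  rewrite mulr_ge0 ?sqr_ge0//=.
  have -> : b = 1 - 4 * s by rewrite /s; lra.
  by rewrite /t; nra.
have hB u : (sqnorm (walk symmetrized c d u) <= (t ^+ 2 * b)%:E * sqnorm u)%E.
  rewrite cd (le_trans (sqnormZ_le _ _))// (EFinM (t ^+ 2)) -muleA lee_wpmul2l//.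
  by rewrite lee_fin sqr_ge0.
pose u (x : G) : R := (x == 1%g)%:R.
have u0 x : 0 <= u x by rewrite ler0n.
have uy : (sqnorm u < +oo)%E.
  apply: sqnorm_fin_support; apply: (@sub_finite_set _ _ [set 1%g]) => // x.
  by rewrite /u/=; case: (x =P 1%g) => //= _ /eqP.
pose v := resolvent symmetrized c d u.
have c0' := ltW c0; have d0' := ltW d0.
have v0 x : 0 <= v x by apply: (resolvent_ge0 c0' d0' tb01 hB).
have vE x : v x = u x + walk symmetrized c d v x.
  exact: (resolventE c0' d0' tb01 hB).
(* Drop the point mass u >= 0 from v = u + B v. *)
have hv x : c * v x + d * \sum_i (v ((g i)^-1 * x)%g + v (g i * x)%g) <= v x.
  rewrite [leRHS]vE [leLHS](_ : _ = walk symmetrized c d v x) ?lerDr//.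
  rewrite /walk big_sumType/= big_split/=; congr (_ + _ * (_ + _)).
  by apply: eq_bigr => i _; rewrite invgK.
have step x i : (0 < v ((g i)^-1 * x)%g -> 0 < v x) /\ (0 < v (g i * x)%g -> 0 < v x).
  have := hv x; rewrite (bigD1 i)//=.
  set S := \sum_(_ | _) _; have S0 : 0 <= S.
    by apply: sumr_ge0 => j _; rewrite addr_ge0.
  have := v0 x; have := v0 ((g i)^-1 * x)%g; have := v0 (g i * x)%g.
  move: (v ((g i)^-1 * x)%g) (v (g i * x)%g) (v x) => p q r p0 q0 r0 H.
  have cr : 0 <= c * r by rewrite mulr_ge0.
  have dS : 0 <= d * S by rewrite mulr_ge0.
  split=> lt0.
    have : 0 < d * p by rewrite mulr_gt0.
    have : 0 <= d * q by rewrite mulr_ge0.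
    by move: H; rewrite !mulrDr; lra.
  have : 0 < d * q by rewrite mulr_gt0.
  have : 0 <= d * p by rewrite mulr_ge0.
  by move: H; rewrite !mulrDr; lra.
have vpos x : 0 < v x.
  (* Quantifying over all y makes [S] a subgroup; it contains the generators by [step], so
     positivity spreads from v 1 >= u 1 = 1 to every point. *)
  pose S : {pred G} := mem [set x | forall y, 0 < v y <-> 0 < v (x * y)%g].
  have : x \in S.
    apply: gen.
      split; first by rewrite inE/= => y; rewrite mul1g.
      move=> a a'; rewrite !inE/= => ha ha' y; rewrite -mulgA.
      by rewrite -ha (ha' (a'^-1 * y)%g) mulVKg.
    move=> i; rewrite inE/= => y; split.
      by move=> vy; apply: (proj1 (step _ i)); rewrite mulKg.
    exact: (proj2 (step _ i)).
  rewrite inE/= => /(_ 1%g); rewrite mulg1 => <-.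
  apply: (@lt_le_trans _ _ (u 1%g)); first by rewrite /u eqxx.
  exact: (le_resolvent c0' d0' tb01 hB).
(* Solving [hv] for the sum gives the factor (1 - c) / d = 2 m / t - m = m - e. *)
exists v; exists (2 * m * (1 - t^-1)).
  by rewrite mulr_gt0 ?mulr_gt0// subr_gt0 invf_lt1//; lra.
split=> // x; rewrite -mE.
rewrite -(ler_pM2l d0).
have -> : d * ((m - 2 * m * (1 - t^-1)) * v x) = v x - c * v x.
  by rewrite /d /c; field; rewrite !gt_eqF//; lra.
by rewrite lerBrDl.
Qed.

Lemma linfty_sumE (I : Type) (r : seq I) (f : I -> linfty R G) x :
  (\sum_(i <- r) f i) x = \sum_(i <- r) f i x.
Proof. by elim/big_rec2: _ => // i y z _ <-. Qed.

(* With [v] as above, the logarithmic increments of [v] along [g i] and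
   [(g i)^-1] have opposite means, although they add up to at most [- e]. *)
Lemma spectral_gap_not_amenable :
  generates g -> spectral_gap R g -> ~ amenable R G.
Proof.
move=> gen gap [phi [phi0 phi1] phiT].
have [v [e e0 [v0 hv]]] := positive_supersolution gen gap.
pose w i x := ln (v ((g i)^-1 * x)%g) - ln (v x).
pose M : R := (n + n)%:R.
(* A Harnack inequality: each term of the positive sum is at most M v(x). Used in both directions it
   bounds [w] by ln M. *)
have hM x i : v ((g i)^-1 * x)%g <= M * v x /\ v (g i * x)%g <= M * v x.
  have : \sum_i (v ((g i)^-1 * x)%g + v (g i * x)%g) <= M * v x.
    by rewrite (le_trans (hv x))// ler_pM2r// gerBl ltW.
  rewrite (bigD1 i)//=; set S := \sum_(_ | _) _; have S0 : 0 <= S.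
    by apply: sumr_ge0 => j _; rewrite addr_ge0// ltW.
  have := v0 ((g i)^-1 * x)%g; have := v0 (g i * x)%g.
  by move: S0; set p := v _; set q := v _; set r := v _; split; lra.
have wM i x : `|w i x| <= ln M.
  have M0 : 0 < M.
    have := hM x i; move=> [/(lt_le_trans (v0 _)) + _].
    by rewrite pmulr_lgt0.
  have lnle y z : v y <= M * v z -> ln (v y) - ln (v z) <= ln M.
    move=> yz; rewrite lerBlDr -lnM ?posrE// ler_ln ?posrE//.
    by rewrite mulr_gt0.
  rewrite ler_norml; apply/andP; split; last exact/lnle/(proj1 (hM _ _)).
  rewrite -lerN2 opprK opprB; apply: lnle.
  by have [_] := hM ((g i)^-1 * x)%g i; rewrite mulVKg.
have bw i : (fun x => (w i x)%:C : R[i]^o) \in @bounded_function R G.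
  apply/bounded_functionP; exists (ln M)%:C => x.
  by rewrite -[leLHS]/((normc _)%:C) normc_real lecR.
(* Since - w i (g i * x) = ln v (g i * x) - ln v x, [f] is the sum of all 2n logarithmic increments
   at x, while invariance gives it mean 0. *)
pose f := \sum_i (Linfty (bw i) - translate (g i)^-1%g (Linfty (bw i))).
have phif : phi f = 0.
  by rewrite /f linear_sum big1// => i _; rewrite linearB phiT subrr.
have := phi0 (- f - e%:C *: linfty1 R G).
have -> : phi (- f - e%:C *: linfty1 R G) = - e%:C.
  by rewrite linearB linearN phif linearZ/= phi1 oppr0 sub0r mulr1.
suff hf x : 0 <= (- f - e%:C *: linfty1 R G) x.
  move/(_ hf); rewrite -rmorphN ler0c oppr_ge0; lra.
have -> : (- f - e%:C *: linfty1 R G) x = - f x - e%:C.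
  by rewrite -[LHS]/(- f x - e%:C * 1) mulr1.
have -> : f x = (\sum_i (w i x - w i (g i * x)%g))%:C.
  rewrite /f linfty_sumE rmorph_sum; apply: eq_bigr => i _.
  rewrite -[LHS]/((w i x)%:C - (w i ((g i)^-1^-1 * x)%g)%:C).
  by rewrite invgK; exact/esym/rmorphB.
rewrite -rmorphN -rmorphB ler0c.
(* ln r <= r - 1 turns the bound on the sum of ratios into f <= - e. *)
have lnle y : ln (v y) - ln (v x) <= v y / v x - 1.
  rewrite -ln_div ?posrE//.
  have := @le_ln1Dx R (v y / v x - 1).
  have -> : 1 + (v y / v x - 1) = v y / v x by ring.
  apply.
  by rewrite ltrBrDl subrr divr_gt0.
have : \sum_i (w i x - w i (g i * x)%g) <=
    \sum_i (v ((g i)^-1 * x)%g + v (g i * x)%g) / v x - M.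
  rewrite /M natrD -[n in - (n%:R + _)]card_ord.
  rewrite -[n in - (_ + n%:R)]card_ord -!sumr_const -big_split -sumrB.
  apply: ler_sum => i _; rewrite /w mulKg opprB.
  by rewrite mulrDl /=; have := lnle ((g i)^-1 * x)%g; have := lnle (g i * x)%g; lra.
have : \sum_i (v ((g i)^-1 * x)%g + v (g i * x)%g) / v x <= M - e.
  by rewrite -mulr_suml ler_pdivrMr.
lra.
Qed.

End NotAmenable.

(** * Spectral gap and invertibility of the pencil *)

Section Invertibility.
Variables (R : realType) (G : groupType) (n : nat) (g : 'I_n -> G).
Local Notation pencil := (pencil (@left_regular R G) g).

(** The walk has real weights and acts on real and imaginary parts separately, so estimates for real
    functions carry over. *)
Lemma sum_sqrE (f : G -> R[i]^o) :
  sum_sqr f = (sqnorm (fun x => complex.Re (f x)) + sqnorm (fun x => complex.Im (f x)))%E.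
Proof.
rewrite /sqnorm -esumD; try by move=> x _; rewrite lee_fin sqr_ge0.
apply: eq_esum => x _; rewrite -EFinD; congr EFin.
by case: (f x) => a b /=; rewrite sqr_sqrtr// addr_ge0// sqr_ge0.
Qed.

Lemma l2_norm_le (k : R) (f f' : l2 R G) : 0 <= k ->
  `|f| <= k%:C * `|f'| <-> (sum_sqr f <= (k ^+ 2)%:E * sum_sqr f')%E.
Proof.
move=> k0; rewrite -[leLHS]/((Num.sqrt _)%:C) -[X in _ * X]/((Num.sqrt _)%:C).
rewrite -rmorphM lecR -(fine_sum_sqr f) -(fine_sum_sqr f') -EFinM lee_fin.
rewrite -[in X in X <-> _](ger0_norm k0) -sqrtr_sqr -sqrtrM ?sqr_ge0//.
by rewrite ler_sqrt// mulr_ge0 ?sqr_ge0// fine_sum_sqr_ge0.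
Qed.

Lemma l2_addE (f f' : l2 R G) x : (f + f') x = f x + f' x.
Proof. by []. Qed.

Lemma l2_scaleE (a : R[i]) (f : l2 R G) x : (a *: f) x = a * f x.
Proof. by []. Qed.

Lemma l2_sumE (I : Type) (r : seq I) (f : I -> l2 R G) x :
  (\sum_(i <- r) f i) x = \sum_(i <- r) f i x.
Proof. by elim/big_rec2: _ => // i y z _ <-. Qed.

Lemma pencilE z f x : pencil z f x =
  z 0 ord0 * f x + \sum_i z 0 (lift ord0 i) * f ((g i)^-1 * x)%g.
Proof.
by rewrite /Defs.pencil l2_addE l2_scaleE l2_sumE.
Qed.

(** The bounded inverse gives ||f|| <= |M| ||A(z) f||. Eliminating z_0 writes A(z) f as the sum of
    z_i (lambda(g_i) f - f), to which Cauchy-Schwarz applies; [Z] bounds each |z_i|^2. *)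
Lemma invertible_spectral_gap (z : 'rV[R[i]]_n.+1) :
  \sum_i z 0 i = 0 -> invertible_operator (pencil z) -> spectral_gap R g.
Proof.
move=> z0 [S [[linS [M hM]] ApK _]].
pose Z : R := \sum_i normc (z 0 (lift ord0 i)) ^+ 2.
have Z0 : 0 <= Z by apply: sumr_ge0 => i _; exact: sqr_ge0.
exists (normc M ^+ 2 * (n%:R * Z)) => u fu u0.
have uy : (sqnorm u < +oo)%E := sqnorm_fin_support fu.
have uL : (fun x => (u x)%:C : R[i]^o) \in @square_summable R G.
  by apply/square_summableP; rewrite -sqnormE.
pose f := L2 uL.
(* The operator bound [M] lies in R[i]; its modulus serves as a real constant. *)
have SA : (sum_sqr f <= (normc M ^+ 2)%:E * sum_sqr (pencil z f))%E.
  apply/(l2_norm_le _ _ (normc_ge0 M)); rewrite -[X in `|X| <= _](ApK f).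
  rewrite -[(normc M)%:C]/(`|M|) -[X in _ * X]normr_id -normrM.
  by rewrite (le_trans (hM _))// real_ler_norm// ger0_real// (le_trans _ (hM _)).
rewrite sqnormE (le_trans SA)// (EFinM (normc M ^+ 2)) -muleA.
rewrite lee_wpmul2l ?lee_fin ?sqr_ge0//.
rewrite -esum_sum; last by move=> x i _ _; rewrite lee_fin sqr_ge0.
under eq_esum do rewrite sumEFin.
rewrite -esum_EFinZl; last 2 first.
- by rewrite mulr_ge0.
- by move=> x; apply: sumr_ge0 => i _; exact: sqr_ge0.
apply: le_esum => x _; rewrite lee_fin.
have -> : pencil z f x =
    \sum_i z 0 (lift ord0 i) * (u ((g i)^-1 * x)%g - u x)%:C.
  rewrite pencilE; move: z0; rewrite big_ord_recl => /eqP.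
  rewrite addr_eq0 => /eqP ->; rewrite mulNr addrC mulr_suml -sumrB.
  by apply: eq_bigr => i _; rewrite rmorphB mulrBr.
have normc_sum (I : finType) (F : I -> R[i]) :
    normc (\sum_i F i) <= \sum_i normc (F i).
  elim/big_rec2: _ => [|i a b _ ab]; first by rewrite normc0.
  by rewrite (le_trans (le_normcD _ _))// lerD2l.
apply: (@le_trans _ _ ((\sum_i normc (z 0 (lift ord0 i)) *
    `|u ((g i)^-1 * x)%g - u x|) ^+ 2)).
  rewrite lerXn2r ?nnegrE ?normc_ge0//.
    by apply: sumr_ge0 => i _; rewrite mulr_ge0 ?normc_ge0.
  rewrite (le_trans (normc_sum _ _))//; apply: ler_sum => i _.
  by rewrite normcM normc_real.
apply: (le_trans (sqr_sum_le _)); rewrite card_ord -mulrA ler_wpM2l//.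
rewrite mulr_sumr; apply: ler_sum => i _.
rewrite exprMn real_normK ?num_real// ler_wpM2r ?sqr_ge0//.
by rewrite /Z (bigD1 i)//= lerDl; apply: sumr_ge0 => j _; exact: sqr_ge0.
Qed.

(* With these coefficients the pencil is [1 - lazy_walk]. *)
Lemma spectral_gap_invertible : spectral_gap R g ->
  exists z : 'rV[R[i]]_n.+1,
    [/\ z != 0, \sum_i z 0 i = 0 & invertible_operator (pencil z)].
Proof.
move=> gap; have := spectral_gap_card gap; rewrite card_ord => n0.
have nR0 : n%:R != 0 :> R by rewrite pnatr_eq0 -lt0n.
have [b b01 hb] := lazy_walk_contract gap.
pose c : R := 2^-1; pose d : R := (2 * #|'I_n|%:R)^-1.
have c0 : 0 <= c by rewrite /c invr_ge0.
have d0 : 0 <= d by rewrite /d invr_ge0 mulr_ge0.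
(* The leading coefficient of 1 - [lazy_walk] is 1 - 1/2, which is again [c]. *)
pose z : 'rV[R[i]]_n.+1 :=
  \row_j (if unlift ord0 j is Some _ then - d else c)%:C.
have zE0 : z 0 ord0 = c%:C by rewrite mxE unlift_none.
have zE i : z 0 (lift ord0 i) = - d%:C by rewrite mxE liftK rmorphN.
pose res := resolvent g c d.
have resE := resolventE c0 d0 b01 hb.
have res_walk := resolvent_walk c0 d0 b01 hb.
have res_lin := resolvent_linear c0 d0 b01 hb.
have [K K0 hK] := resolvent_bound c0 d0 b01 hb.
have ReL (f : l2 R G) : (sqnorm (fun x => complex.Re (f x)) < +oo)%E.
  have /square_summableP : (f : G -> R[i]^o) \in @square_summable R G by case: f.
  by rewrite sum_sqrE; apply: le_lt_trans; rewrite leeDl// sqnorm_ge0.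
have ImL (f : l2 R G) : (sqnorm (fun x => complex.Im (f x)) < +oo)%E.
  have /square_summableP : (f : G -> R[i]^o) \in @square_summable R G by case: f.
  by rewrite sum_sqrE; apply: le_lt_trans; rewrite leeDr// sqnorm_ge0.
pose Sf (f : l2 R G) : G -> R[i]^o :=
  fun x => (res (fun y => complex.Re (f y)) x +i* res (fun y => complex.Im (f y)) x).
have hS f : (sum_sqr (Sf f) <= K%:E * sum_sqr f)%E.
  rewrite !sum_sqrE ge0_muleDr ?sqnorm_ge0// leeD//; first exact/hK/ReL.
  exact/hK/ImL.
have SL f : Sf f \in @square_summable R G.
  apply/square_summableP; apply: (le_lt_trans (hS f)).
  by rewrite lte_mul_pinfty ?lee_fin//; apply/square_summableP; case: f.
pose S f := L2 (SL f).
have pencil_ReIm f x : pencil z f x =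
    ((- 1 * walk g c d (fun y => complex.Re (f y)) x + complex.Re (f x)) +i*
     (- 1 * walk g c d (fun y => complex.Im (f y)) x + complex.Im (f x))).
  rewrite pencilE zE0; under eq_bigr do rewrite zE.
  rewrite -mulr_sumr /walk.
  have -> : \sum_i f ((g i)^-1 * x)%g = (\sum_i complex.Re (f ((g i)^-1 * x)%g)) +i*
      (\sum_i complex.Im (f ((g i)^-1 * x)%g)).
    elim/big_rec3: _ => // i p q r _ ->.
    by case: (f _) => ? ?.
  move: (\sum_i complex.Re _) (\sum_i complex.Im _) => p q; case: (f x) => r s.
  by congr (_ +i* _); rewrite /c /=; field.
exists z; split.
- apply/eqP => /rowP/(_ ord0); rewrite zE0 mxE => -[/eqP].
  by rewrite invr_eq0 pnatr_eq0.
- rewrite big_ord_recl zE0; under eq_bigr do rewrite zE.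
  rewrite sumr_const card_ord -mulr_natl mulrN -(rmorph_nat (real_complex R)).
  rewrite -rmorphM -rmorphB /c /d card_ord (_ : _ - _ = 0) ?rmorph0//.
  by field.
have resK u : (sqnorm u < +oo)%E -> res (fun x => - 1 * walk g c d u x + u x) = u.
  move=> uy; have Buy := sqnorm_walk_lty b01 hb uy.
  rewrite /res res_lin// res_walk//; apply/funext => x.
  by rewrite [X in _ + X]resE//; ring.
exists S; split.
- split.
    move=> a f f'; apply/val_inj/funext => x.
    rewrite [RHS](l2_addE (a *: S f) (S f') x) (l2_scaleE a (S f)).
    rewrite -[LHS]/(Sf (a *: f + f') x) -[S f x]/(Sf f x) -[S f' x]/(Sf f' x) /Sf.
    rewrite (_ : (fun y => complex.Re _) = fun y => complex.Re a * complex.Re (f y)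
        + (- complex.Im a * complex.Im (f y) + complex.Re (f' y))); last first.
      apply/funext => y; rewrite l2_addE l2_scaleE.
      by case: a (f y) (f' y) => [? ?] [? ?] [? ?] /=; ring.
    rewrite (_ : (fun y => complex.Im _) = fun y => complex.Re a * complex.Im (f y)
        + (complex.Im a * complex.Re (f y) + complex.Im (f' y))); last first.
      apply/funext => y; rewrite l2_addE l2_scaleE.
      by case: a (f y) (f' y) => [? ?] [? ?] [? ?] /=; ring.
    rewrite /res !res_lin//; try exact: sqnorm_linear_lty.
    by case: a => ? ?; congr (_ +i* _) => /=; ring.
  exists (Num.sqrt K)%:C => f; apply/l2_norm_le; first exact: sqrtr_ge0.
  by rewrite sqr_sqrtr//; exact: hS.
- move=> f; apply/val_inj/funext => x; rewrite -[LHS]/(Sf (pencil z f) x) /Sf.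
  rewrite (_ : (fun y => complex.Re _) =
      fun y => - 1 * walk g c d (fun y => complex.Re (f y)) y + complex.Re (f y)).
    rewrite resK// (_ : (fun y => complex.Im _) =
        fun y => - 1 * walk g c d (fun y => complex.Im (f y)) y + complex.Im (f y)).
      by rewrite resK// -[RHS]/(f x); case: (f x).
    by apply/funext => y; rewrite pencil_ReIm.
  by apply/funext => y; rewrite pencil_ReIm.
- move=> f; apply/val_inj/funext => x.
  have SRe : (fun y => complex.Re (S f y)) = res (fun y => complex.Re (f y)) by [].
  have SIm : (fun y => complex.Im (S f y)) = res (fun y => complex.Im (f y)) by [].
  apply: (etrans (pencil_ReIm (S f) x)); rewrite SRe SIm.
  have -> : complex.Re (S f x) = res (fun y => complex.Re (f y)) x by [].
  have -> : complex.Im (S f x) = res (fun y => complex.Im (f y)) x by [].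
  rewrite {2 4}/res !resE// -/res.
  have -> : val f x = f x by []. case: (f x) => p q; congr (_ +i* _) => /=; ring.
Qed.

End Invertibility.

(** * Invariant means in the absence of a spectral gap *)

Section UltraLimit.
Variables (R : realType) (U : set_system nat).
Hypothesis UU : UltraFilter U.

(** The image of [U] is an ultrafilter on the compact interval [- M, M]. *)
Lemma is_cvg_ultra (a : nat -> R) (M : R) : (forall k, `|a k| <= M) -> cvg (a @ U).
Proof.
move=> aM; have : compact `[- M, M]%classic by exact: segment_compact.
rewrite compact_ultra.
have UaU : UltraFilter (a @ U).
  split=> [|F FF sUF]; first exact: fmap_proper_filter.
  apply/seteqP; split => // A FA.
  have [//|] := in_ultra_setVsetC (a @^-1` A) UU.
  rewrite preimage_setC => /sUF FnA.
  have /filter_ex[x [//]] : F (A `&` ~` A) by exact: filterI.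
move=> /(_ (a @ U) UaU)[]; last by move=> l [_ al]; apply/cvg_ex; exists l.
by apply: nearW => k; rewrite /= in_itv/= -ler_norml.
Qed.

End UltraLimit.

(** * Means with density u^2 / ||u||^2 *)

Section Average.
Variables (R : realType) (G : groupType).
Implicit Types u a : G -> R.

Definition average u a : R :=
  (\sum_(x \in [set: G]) a x * u x ^+ 2) / fine (sqnorm u).

(** [X] may be larger than the support, so that u and a translate of it can be summed over a common
    set. *)
Lemma sqnorm_fset u (X : {fset G}) : (forall x, x \notin X -> u x = 0) ->
  sqnorm u = (\sum_(x <- X) u x ^+ 2)%:E.
Proof.
move=> uX; rewrite -sumEFin.
rewrite -fsbigTE; last by move=> x /uX ->; rewrite expr0n.
have fX : finite_set [set` X] by exact: finite_fset.
rewrite -(fsbig_widen [set` X] setT)//.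
  rewrite -esum_fset//; last by move=> x _; rewrite lee_fin sqr_ge0.
  rewrite [RHS]esum_mkcond; apply: eq_esum => x _; case: ifPn => //.
  by rewrite notin_setE/= => /negP /uX ->; rewrite expr0n.
by move=> x [_ /negP /uX] /= ->; rewrite expr0n.
Qed.

Lemma average_fset u a (X : {fset G}) : (forall x, x \notin X -> u x = 0) ->
  average u a = (\sum_(x <- X) a x * u x ^+ 2) / (\sum_(x <- X) u x ^+ 2).
Proof.
move=> uX; rewrite /average (sqnorm_fset uX)/=; congr (_ / _); apply: fsbigTE.
by move=> x /uX ->; rewrite expr0n mulr0.
Qed.

Variable u : G -> R.
Hypotheses (fu : finite_set [set x | u x != 0]) (u0 : (0 < sqnorm u)%E).

Let X : {fset G} := fset_set [set x | u x != 0].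

Let uX x : x \notin X -> u x = 0.
Proof. by rewrite /X in_fset_set// notin_setE/= => /negP; rewrite negbK => /eqP. Qed.

Let N0 : 0 < \sum_(x <- X) u x ^+ 2.
Proof. by rewrite -lte_fin -(sqnorm_fset uX). Qed.

Lemma average_linear (c : R) a a' :
  average u (fun x => c * a x + a' x) = c * average u a + average u a'.
Proof.
rewrite !(average_fset _ uX) mulrA mulr_sumr -mulrDl -big_split/=.
by congr (_ / _); apply: eq_bigr => x _; ring.
Qed.

Lemma average_ge0 a : (forall x, 0 <= a x) -> 0 <= average u a.
Proof.
move=> a0; rewrite (average_fset _ uX) divr_ge0 ?(ltW N0)//.
by apply: sumr_ge0 => x _; rewrite mulr_ge0 ?sqr_ge0.
Qed.

Lemma average_cst (c : R) : average u (fun=> c) = c.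
Proof. by rewrite (average_fset _ uX) -mulr_sumr mulfK// gt_eqF. Qed.

Lemma norm_average_le a M : (forall x, `|a x| <= M) -> `|average u a| <= M.
Proof.
move=> aM; rewrite (average_fset _ uX) normrM normfV (gtr0_norm N0) ler_pdivrMr//.
rewrite (le_trans (ler_norm_sum _ _ _))// mulr_sumr; apply: ler_sum => x _.
by rewrite normrM (ger0_norm (sqr_ge0 _)) ler_wpM2r ?sqr_ge0.
Qed.

(** A change of variables moves the translation from a to u; the two densities are then close in l1
    because u and its translate are close in l2. *)
Lemma average_translate_le (h : G) a (M k : R) : 0 < k -> (forall x, `|a x| <= M) ->
  ((k ^+ 2)%:E * sqnorm (fun x => u (h^-1 * x)%g - u x)%R <= sqnorm u)%E ->
  `|average u (fun x => a (h * x)%g) - average u a| <= M * (3 / k).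
Proof.
move=> k0 aM; pose uh x := u (h^-1 * x)%g.
pose Y : {fset G} := (X `|` [fset (h * x)%g | x in X])%fset.
have uY x : x \notin Y -> u x = 0.
  by rewrite inE negb_or => /andP[/uX].
have uhY x : x \notin Y -> uh x = 0.
  rewrite inE negb_or => /andP[_ xX]; apply: uX; apply: contra xX => xX.
  by apply/imfsetP; exists (h^-1 * x)%g => //=; rewrite mulVKg.
have uhuY x : x \notin Y -> uh x - u x = 0.
  by move=> xY; rewrite uhY// uY// subrr.
rewrite (sqnorm_fset uhuY) (sqnorm_fset uY) -EFinM lee_fin => hk.
have M0 : 0 <= M by exact: le_trans (normr_ge0 _) (aM 1%g).
have NE : \sum_(x <- Y) uh x ^+ 2 = \sum_(x <- Y) u x ^+ 2.
  apply: EFin_inj; rewrite -(sqnorm_fset uY) -(sqnorm_fset uhY).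
  exact: sqnorm_translate.
have -> : average u (fun x => a (h * x)%g) = average uh a.
  rewrite /average (sqnorm_translate h u); congr (_ / _).
  rewrite [RHS](@reindex_fsbigT _ _ _ _ _ (fun x => h * x)%g); last first.
    by exists (fun x => h^-1 * x)%g => x; rewrite ?mulKg ?mulVKg.
  by apply: eq_fsbigr => x _; rewrite /uh mulKg.
rewrite (average_fset _ uY) (average_fset _ uhY) NE -mulrBl -sumrB.
have NY0 : 0 < \sum_(x <- Y) u x ^+ 2 by rewrite -lte_fin -(sqnorm_fset uY).
rewrite normrM normfV (gtr0_norm NY0) ler_pdivrMr//.
rewrite (le_trans (ler_norm_sum _ _ _))//.
(* AM-GM: [|s ^ 2 - t ^ 2| <= (k (s - t) ^ 2 + k^-1 (s + t) ^ 2) / 2] *)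
apply: (@le_trans _ _ (M * \sum_(x <- Y) (k / 2 * (uh x - u x) ^+ 2 +
    k^-1 * (uh x ^+ 2 + u x ^+ 2)))).
  rewrite mulr_sumr; apply: ler_sum => x _; rewrite -mulrBr normrM ler_pM//.
  rewrite subr_sqr normrM; move: (uh x) (u x) => s t.
  have ki : k * k^-1 = 1 by rewrite mulfV// gt_eqF.
  have ki0 : 0 < k^-1 by rewrite invr_gt0.
  rewrite -(real_normK (num_real (s - t))).
  have := @sqr_ge0 R (`|s - t| - k^-1 * `|s + t|).
  have : `|s + t| ^+ 2 <= 2 * (s ^+ 2 + t ^+ 2).
    by rewrite real_normK ?num_real//; have := sqr_ge0 (s - t); nra.
  move: `|s - t| `|s + t| => p q q2 pq.
  have -> : p * q = k / 2 * p ^+ 2 + k^-1 * (q ^+ 2 / 2) - k / 2 * (p - k^-1 * q) ^+ 2.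
    by field; rewrite gt_eqF.
  have : 0 <= k / 2 * (p - k^-1 * q) ^+ 2 by rewrite mulr_ge0// ltW// divr_gt0.
  have : k^-1 * (q ^+ 2 / 2) <= k^-1 * (s ^+ 2 + t ^+ 2).
    by rewrite ler_pM2l//; lra.
  lra.
rewrite -mulrA ler_wpM2l// !big_split/= -!mulr_sumr big_split/= NE.
have kk : k / 2 * (\sum_(x <- Y) (uh x - u x) ^+ 2) <=
    (2 * k)^-1 * \sum_(x <- Y) u x ^+ 2.
  have -> : k / 2 * (\sum_(x <- Y) (uh x - u x) ^+ 2) =
      (2 * k)^-1 * (k ^+ 2 * \sum_(x <- Y) (uh x - u x) ^+ 2).
    by field; rewrite gt_eqF.
  by rewrite ler_wpM2l// invr_ge0 mulr_ge0// ltW.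
apply: (le_trans (lerD kk (lexx _))).
move: (\sum_(x <- Y) u x ^+ 2) NY0 => N NY0.
(* The constant 5/2 obtained here is rounded up to 3. *)
have -> : (2 * k)^-1 * N + k^-1 * (N + N) = (5 / 2) / k * N.
  by field; rewrite gt_eqF.
by rewrite ler_wpM2r ?ler_wpM2r ?invr_ge0 ?ltW//; lra.
Qed.

End Average.

(** * The invariant mean as an ultralimit *)

Section Amenable.
Variables (R : realType) (G : groupType).

Lemma linfty_bound (f : linfty R G) :
  exists M : R, forall x, `|complex.Re (f x)| <= M /\ `|complex.Im (f x)| <= M.
Proof.
have /bounded_functionP[M fM] : (f : G -> R[i]^o) \in @bounded_function R G by case: f.
exists (complex.Re M) => x; have : normc (f x) <= complex.Re M.
  by have := fM x; rewrite lecE => /andP[].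
case: (f x) => a b /= abM; split; apply: le_trans abM;
  by rewrite -sqrtr_sqr ler_wsqrtr// ?lerDl ?lerDr sqr_ge0.
Qed.

Lemma linfty_linearE (c : R[i]) (f f' : linfty R G) x :
  (c *: f + f') x = c * f x + f' x.
Proof. by []. Qed.

Lemma translate1 (f : linfty R G) : translate 1%g f = f.
Proof. by apply/val_inj/funext => x /=; rewrite invg1 mul1g. Qed.

Lemma translateM (h k : G) (f : linfty R G) :
  translate (h * k)%g f = translate h (translate k f).
Proof. by apply/val_inj/funext => x /=; rewrite invgM mulgA. Qed.

Lemma no_spectral_gap_amenable (n : nat) (g : 'I_n -> G) :
  generates g -> ~ spectral_gap R g -> amenable R G.
Proof.
move=> gen nogap.
have /choice[u hu] : forall k : nat, exists u : G -> R,
    finite_set [set x | u x != 0] /\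
    (((k.+1%:R ^+ 2)%:E * \sum_i sqnorm (fun x => u ((g i)^-1 * x)%g - u x)%R
      < sqnorm u)%E).
  (* The gap fails for C = (k + 1)^2, which is what [average_translate_le] needs for an error 3 M /
     (k + 1). *)
  move=> k; apply: contrapT => nou; apply: nogap; exists (k.+1%:R ^+ 2) => u fu _.
  by rewrite leNgt; apply/negP => hu; apply: nou; exists u.
have fu k := proj1 (hu k).
have S0 k : (0 <= \sum_i sqnorm (fun x => u k ((g i)^-1 * x)%g - u k x)%R)%E.
  by apply: sume_ge0 => i _; exact: sqnorm_ge0.
have u0 k : (0 < sqnorm (u k))%E.
  by apply: le_lt_trans (proj2 (hu k)); rewrite mule_ge0// lee_fin sqr_ge0.
(* All bounded sequences converge along [U], and limits along [\oo] persist since [U] is finer. *)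
have [U [UU sU]] := ultraFilterLemma (eventually_filter : ProperFilter \oo).
pose L (a : G -> R) : R := lim ((fun k => average (u k) a) @ U).
have cvgL (a : G -> R) : (exists M, forall x, `|a x| <= M) ->
    (fun k => average (u k) a) @ U --> L a.
  move=> [M aM]; apply: (is_cvg_ultra UU (M := M)) => k.
  exact: norm_average_le.
have L_linear c a a' : (exists M, forall x, `|a x| <= M) ->
    (exists M, forall x, `|a' x| <= M) ->
    L (fun x => c * a x + a' x) = c * L a + L a'.
  move=> ha ha'; apply/cvg_lim => //.
  under eq_fun do rewrite average_linear//.
  by apply: cvgD; [apply: cvgMr; exact: cvgL|exact: cvgL].
have L_ge0 a : (forall x, 0 <= a x) -> (exists M, forall x, `|a x| <= M) -> 0 <= L a.
  move=> a0 /cvgL aL; apply: (cvgr_to_ge aL); apply: nearW => k.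
  exact: average_ge0.
have L_cst c : L (fun=> c) = c.
  apply/cvg_lim => //; under eq_fun do rewrite average_cst//.
  exact: cvg_cst.
have L_translate i a : (exists M, forall x, `|a x| <= M) ->
    L (fun x => a (g i * x)%g) = L a.
  move=> ha; have [M aM] := ha; apply/cvg_lim => //.
  have -> : (fun k => average (u k) (fun x => a (g i * x)%g)) =
     (fun k => (average (u k) (fun x => a (g i * x)%g) - average (u k) a) +
       average (u k) a) by apply/funext => k; rewrite subrK.
  rewrite -[X in _ --> X]add0r; apply: cvgD; last exact: cvgL.
  apply: (@cvg_trans _ ((fun k => average (u k) (fun x => a (g i * x)%g) -
    average (u k) a) @ \oo)); first by move=> A; exact: sU.
  apply/norm_cvg0P.
  apply: (@squeeze_cvgr _ _ _ _ (fun=> 0) (fun k => M * 3 * k.+1%:R^-1)).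
  - apply: nearW => k; rewrite normr_ge0/= -mulrA.
    apply: average_translate_le => //.
    apply: (le_trans _ (ltW (proj2 (hu k)))); apply: lee_wpmul2l.
      by rewrite lee_fin sqr_ge0.
    by rewrite (bigD1 i)//= leeDl// sume_ge0// => j _; exact: sqnorm_ge0.
  - exact: cvg_cst.
  - rewrite -[X in _ --> X](mulr0 (M * 3)); apply: cvgMr.
    exact: cvg_harmonic.
have bRe (f : linfty R G) : exists M, forall x, `|complex.Re (f x)| <= M.
  by have [M hM] := linfty_bound f; exists M => x; have [] := hM x.
have bIm (f : linfty R G) : exists M, forall x, `|complex.Im (f x)| <= M.
  by have [M hM] := linfty_bound f; exists M => x; have [] := hM x.
pose phi (f : linfty R G) : R[i] :=
  L (fun x => complex.Re (f x)) +i* L (fun x => complex.Im (f x)).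
have bD (c : R) (a a' : G -> R) : (exists M, forall x, `|a x| <= M) ->
    (exists M, forall x, `|a' x| <= M) ->
    exists M, forall x, `|c * a x + a' x| <= M.
  move=> [M aM] [M' aM']; exists (`|c| * M + M') => x.
  by rewrite (le_trans (ler_normD _ _))// normrM lerD// ler_wpM2l.
have phi_scalar : scalar phi.
  move=> c f f'; rewrite /phi.
  rewrite (_ : (fun x => complex.Re _) = fun x => complex.Re c * complex.Re (f x)
      + (- complex.Im c * complex.Im (f x) + complex.Re (f' x))); last first.
    apply/funext => x; rewrite linfty_linearE.
    by case: c (f x) (f' x) => [? ?] [? ?] [? ?] /=; ring.
  rewrite (_ : (fun x => complex.Im _) = fun x => complex.Re c * complex.Im (f x)
      + (complex.Im c * complex.Re (f x) + complex.Im (f' x))); last first.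
    apply/funext => x; rewrite linfty_linearE.
    by case: c (f x) (f' x) => [? ?] [? ?] [? ?] /=; ring.
  rewrite !L_linear//; try exact: bD.
  by case: c => ? ?; congr (_ +i* _) => /=; ring.
pose Phi : {scalar linfty R G} :=
  HB.pack phi (GRing.isLinear.Build _ _ _ _ phi phi_scalar).
have phi_translate h f : phi (translate h f) = phi f.
  (* The elements that leave [phi] invariant form a subgroup, so the generators suffice. *)
  pose S : {pred G} := mem [set h | forall f, phi (translate h f) = phi f].
  suff : h \in S by rewrite inE; apply.
  apply: gen => [|i].
    split; first by rewrite inE/= => f'; rewrite translate1.
    move=> h1 h2; rewrite !inE/= => H1 H2 f'.
    by rewrite translateM H1 -[LHS]H2 -translateM mulgV translate1.
  rewrite inE/= => f'.
  have gV f1 : phi (translate (g i)^-1%g f1) = phi f1.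
    rewrite /phi /= invgK; congr (_ +i* _).
      exact: (L_translate i (fun x => complex.Re (f1 x)) (bRe f1)).
    exact: (L_translate i (fun x => complex.Im (f1 x)) (bIm f1)).
  by rewrite -[LHS]gV -translateM mulVg translate1.
exists Phi => //; split=> [f f0|]; last first.
  by rewrite -[LHS]/(phi (linfty1 R G)) /phi /= !L_cst.
rewrite -[Phi f]/(phi f) lecE /phi /=.
have -> : (fun x => complex.Im (f x)) = (fun=> 0).
  by apply/funext => x; have := f0 x; rewrite lecE => /andP[/eqP].
rewrite L_cst eqxx /=; apply: L_ge0 => //.
by move=> x; have := f0 x; rewrite lecE => /andP[].
Qed.

End Amenable.

Theorem theorem4p4 (R : realType) (G : groupType) (n : nat) (g : 'I_n -> G)
    (g_generates : generates g) :
  amenable R G <->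
  @hyperplane0 R[i] n `<=` projective_spectrum (@left_regular R G) g.
Proof.
split=> [amen p p0|H0].
  move=> inv; apply: (spectral_gap_not_amenable g_generates _ amen).
  exact: invertible_spectral_gap inv.
apply: (no_spectral_gap_amenable g_generates) => gap.
have [z [z0 sz inv]] := spectral_gap_invertible gap.
(* The coordinates [z] need not be the chosen representative of their class, so both memberships go
   through independence of the representative. *)
pose zh : homogeneous_coordinates R[i] n := exist _ z z0.
have := H0 (\pi_(projective_space R[i] n) zh)%qT.
move/(_ (proj2 (hyperplane0P zh) sz)).
by move/(projective_spectrumP _ (@left_regular_bounded R G)); apply.
Qed.
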